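(* Let $A$ be a Noetherian $\mathbb{Z}^{n}$-graded domain such that $A_{\mathbf 0}$ is a field. Then there exist finitely many chambers $\sigma_1,\sigma_2,\ldots,\sigma_m$ of $A$ such that $$C(A)=\bigcup_{i=1}^{m}\sigma_i.$$
   Context: Rings are commutative with $1$. A $\mathbb{Z}^n$-graded ring is a ring $A=\bigoplus_{\mathbf a\in\mathbb{Z}^n}A_{\mathbf a}$ with additive subgroups $A_{\mathbf a}$ such that $A_{\mathbf a}A_{\mathbf b}\subset A_{\mathbf a+\mathbf b}$; a $\mathbb{Z}^n$-graded domain is one that is an integral domain. Put $C(A)=\sum_{A_{\mathbf a}\ne0}\mathbb{R}_{\ge0}\mathbf a\subset\mathbb{R}^n$. A cone in $\mathbb{R}^n$ is a subset $\sigma$ closed under addition and with $\mathbb{R}_{\ge0}\mathbf a\subset\sigma$ for all $\mathbf a\in\sigma$; $\dim\sigma$ is the dimension of the real vector space $\sigma-\sigma$, and ${\rm rel.int}(\sigma)$ is the relative interior of $\sigma$ (interior in $\sigma-\sigma$). For $\mathbf a\in\mathbb{Q}^n$, $I_{\mathbf a}(A)$ is the ideal of $A$ generated by $\bigcup_{\mathbf b\in\mathbb{R}_{>0}\mathbf a\cap\mathbb{Z}^n}A_{\mathbf b}$, and $J_{\mathbf a}(A)=\sqrt{I_{\mathbf a}(A)}$. A ray ideal cone of $A$ is a cone $\sigma$ such that $\sigma-\sigma$ is an $\mathbb{R}$-subspace spanned by finitely many elements of $\mathbb{Q}^n$ and $J_{\mathbf a}(A)=J_{\mathbf b}(A)\ne0$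 for all $\mathbf a,\mathbf b\in{\rm rel.int}(\sigma)\cap\mathbb{Q}^n$. A chamber of $A$ is a ray ideal cone $\sigma$ with $\dim\sigma=\dim C(A)$. *)

(* Defs.v *)
From mathcomp Require Import all_boot all_order all_algebra.
From mathcomp Require Import all_classical all_reals all_analysis.

Set Implicit Arguments.
Unset Strict Implicit.
Unset Printing Implicit Defensive.

Import GRing.Theory Num.Theory numFieldNormedType.Exports.

Local Open Scope classical_set_scope.
Local Open Scope ring_scope.

Section Ring.
Variable A : idomainType.

Definition is_ideal (I : set A) : Prop :=
  [/\ I 0, forall x y, I x -> I y -> I (x + y) & forall r x, I x -> I (r * x)].

Definition ideal_gen (S : set A) : set A := smallest is_ideal S.

Definition radical (I : set A) : set A := [set x | exists k : nat, I (x ^+ k)].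

Definition noetherian : Prop :=
  forall I : set A, is_ideal I -> exists s : seq A, I = ideal_gen [set` s].

Definition is_field_subset (K : set A) : Prop :=
  [/\ K 1, forall x y, K x -> K y -> K (x - y),
      forall x y, K x -> K y -> K (x * y)
    & forall x, K x -> x != 0 -> exists2 y, K y & x * y = 1].

(* [G a] is the homogeneous component of degree [a]. In the last clause the
   sum [\sum_(a \in [set: _]) f a] is the sum over the (finite) support of [f]. *)
Definition is_grading (n : nat) (G : 'rV[int]_n -> set A) : Prop :=
  [/\ forall a, G a 0 /\ (forall x y, G a x -> G a y -> G a (x - y)),
      forall a b x y, G a x -> G b y -> G (a + b) (x * y)
    & forall x, exists! f : 'rV[int]_n -> A,
        [/\ finite_set [set a | f a != 0], forall a, G a (f a)
          & x = \sum_(a \in [set: 'rV[int]_n]) f a]].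

End Ring.

Section Cones.
Variables (R : realType) (n : nat).

Definition of_int (a : 'rV[int]_n) : 'rV[R]_n := map_mx intr a.
Definition of_rat (a : 'rV[rat]_n) : 'rV[R]_n := map_mx ratr a.

Definition is_cone (s : set 'rV[R]_n) : Prop :=
  (forall x y, s x -> s y -> s (x + y)) /\
  (forall (t : R) x, 0 <= t -> s x -> s (t *: x)).

Definition cone_diff (s : set 'rV[R]_n) : set 'rV[R]_n :=
  [set x - y | x in s & y in s].

(* For a nonempty cone [s], [cone_diff s] is a subspace, hence of the form
   [[set` V]] for a unique [V]; the default value [0%VS] is only used when
   there is no such [V]. *)
Definition cone_dim (s : set 'rV[R]_n) : nat :=
  \dim (xget 0%VS [set V : {vspace 'rV[R]_n} | [set` V] = cone_diff s]).

Definition rel_int (s : set 'rV[R]_n) : set 'rV[R]_n :=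
  [set x | s x /\ within (cone_diff s) (nbhs x) s].

Definition rationally_spanned (s : set 'rV[R]_n) : Prop :=
  exists q : seq 'rV[rat]_n, s = [set` <<[seq of_rat v | v <- q]>>%VS].

End Cones.

Section Graded.
Variables (R : realType) (n : nat) (A : idomainType) (G : 'rV[int]_n -> set A).

Definition degree_cone : set 'rV[R]_n :=
  [set v | exists (k : nat) (a : 'I_k -> 'rV[int]_n) (c : 'I_k -> R),
     (forall i, G (a i) <> [set 0] /\ 0 <= c i) /\
     v = \sum_(i < k) c i *: of_int R (a i)].

Definition ray_ideal (a : 'rV[rat]_n) : set A :=
  ideal_gen (\bigcup_(b in [set b | exists2 t : R,
                              0 < t & of_int R b = t *: of_rat R a]) G b).

Definition ray_radical (a : 'rV[rat]_n) : set A := radical (ray_ideal a).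

Definition ray_ideal_cone (s : set 'rV[R]_n) : Prop :=
  [/\ is_cone s, rationally_spanned (cone_diff s)
    & forall a b : 'rV[rat]_n,
        rel_int s (of_rat R a) -> rel_int s (of_rat R b) ->
        ray_radical a = ray_radical b /\ ray_radical b <> [set 0]].

Definition chamber (s : set 'rV[R]_n) : Prop :=
  ray_ideal_cone s /\ cone_dim s = cone_dim degree_cone.

End Graded.

Arguments degree_cone R {n A} G _.
Arguments ray_ideal R {n A} G a _.
Arguments ray_radical R {n A} G a _.

(* Main.v *)
(** By Noetherianity and Dickson's lemma there are finitely many degrees [d i]
    such that every homogeneous element of degree [b] lies in the ideal generated
    by the monomials of degree [b] in elements of the degrees [d i]. Hence [J_a]
    is determined by the subsets [F] of degrees such that [a] is a positive
    combination of [F]. If [a] avoids the hyperplanes spanned by subsets of the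
    degrees, then by Caratheodory only the bases among these subsets matter, and
    they are read off the side of each hyperplane on which [a] lies. So the
    full-dimensional closed cells of this hyperplane arrangement inside [C(A)]
    are chambers, and they cover [C(A)] because every point of it can be moved
    off the hyperplanes in the direction of a generic point. *)

Require Import Defs.
From mathcomp Require Import all_boot all_order all_algebra.
From mathcomp Require Import all_classical all_reals all_analysis.
From mathcomp Require Import zify lra.

Set Implicit Arguments.
Unset Strict Implicit.
Unset Printing Implicit Defensive.

Import Order.TTheory GRing.Theory Num.Theory numFieldNormedType.Exports.

Local Open Scope classical_set_scope.
Local Open Scope ring_scope.

(** * Generated ideals, radicals and the ascending chain condition *)

Section Ideals.
Variable A : idomainType.
Implicit Types (S I : set A) (x y r : A).

Lemma ideal_gen_ideal S : is_ideal (ideal_gen S).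
Proof.
split=> [I [[]]//|x y Ix Iy I|r x Ix I] idI.
  by have [[_ ID _] _] := idI; apply: ID; [apply: Ix|apply: Iy].
by have [[_ _ IM] _] := idI; apply: IM; apply: Ix.
Qed.

Lemma ideal_gen0 S : ideal_gen S 0.
Proof. by case: (ideal_gen_ideal S). Qed.

Lemma ideal_genD S x y : ideal_gen S x -> ideal_gen S y -> ideal_gen S (x + y).
Proof. by case: (ideal_gen_ideal S) => _ + _; apply. Qed.

Lemma ideal_genMl S r x : ideal_gen S x -> ideal_gen S (r * x).
Proof. by case: (ideal_gen_ideal S) => _ _; apply. Qed.

Lemma ideal_gen_in S x : S x -> ideal_gen S x.
Proof. exact: sub_gen_smallest. Qed.

Lemma ideal_gen_min S I : is_ideal I -> S `<=` I -> ideal_gen S `<=` I.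
Proof. exact: smallest_sub. Qed.

Lemma ideal_gen_sub S1 S2 :
  S1 `<=` ideal_gen S2 -> ideal_gen S1 `<=` ideal_gen S2.
Proof. by apply: ideal_gen_min; apply: ideal_gen_ideal. Qed.

(** With one factor fixed, the other factors sending it into an ideal form an ideal, so generators
    suffice, first for [x], then for [y]. *)
Lemma ideal_gen_mul S1 S2 S3 x y :
  (forall u v, S1 u -> S2 v -> ideal_gen S3 (u * v)) ->
  ideal_gen S1 x -> ideal_gen S2 y -> ideal_gen S3 (x * y).
Proof.
move=> S123 S1x S2y.
change ([set z | ideal_gen S3 (z * y)] x).
apply: ideal_gen_min S1x => [|u S1u].
  split=> [|u v|r u] /=; first by rewrite mul0r; apply: ideal_gen0.
    by rewrite mulrDl; apply: ideal_genD.
  by rewrite -mulrA; apply: ideal_genMl.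
change ([set z | ideal_gen S3 (u * z)] y).
apply: ideal_gen_min S2y => [|v S2v]; last exact: S123.
split=> [|w v|r v] /=; first by rewrite mulr0; apply: ideal_gen0.
  by rewrite mulrDr; apply: ideal_genD.
by rewrite mulrCA; apply: ideal_genMl.
Qed.

Lemma ideal_gen_sum S x : ideal_gen S x ->
  exists s : seq (A * A),
    (forall p, p \in s -> S p.2) /\ x = \sum_(p <- s) p.1 * p.2.
Proof.
move: x; apply: ideal_gen_min => [|x Sx]; last first.
  exists [:: (1, x)]; rewrite big_seq1 mul1r; split=> // p.
  by rewrite inE => /eqP->.
split=> [|x y [s [sS ->]] [t [tS ->]]|r x [s [sS ->]]].
- by exists [::]; rewrite big_nil.
- exists (s ++ t); rewrite big_cat; split=> // p.
  by rewrite mem_cat => /orP[/sS|/tS].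
- exists [seq (r * p.1, p.2) | p <- s]; rewrite big_map mulr_sumr; split.
    by move=> _ /mapP[p /sS Sp ->].
  by apply: eq_bigr => p _; rewrite mulrA.
Qed.

Lemma radical_ideal_gen_sub S I :
  is_ideal I -> S `<=` radical I -> ideal_gen S `<=` radical I.
Proof.
move=> idI; apply: ideal_gen_min; have [I0 ID IM] := idI.
split=> [|x y [k Ik] [l Il]|r x [k Ik]].
- by exists 1%N; rewrite expr1.
(* In every binomial term either [y] has exponent at least [l] or [x] has exponent at least [k]. *)
- exists (k + l)%N; rewrite exprDn.
  apply: (big_ind I) => // i _; rewrite -mulr_natl; apply: (IM).
  have [lei|/ltnW lei] := leqP l i.
    by rewrite -{2}(subnK lei) exprD mulrA; apply: IM.
  by rewrite -addnBA // exprD -mulrA mulrC; apply: IM.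
- by exists k; rewrite exprMn; apply: IM.
Qed.

Lemma radical_idem_sub I J :
  I `<=` radical J -> radical I `<=` radical J.
Proof.
move=> IJ x [k /IJ[l]]; rewrite -exprM => Jx; by exists (k * l)%N.
Qed.

(** The ideals generated by initial segments increase, so their union is an ideal; finitely many
    generators of the whole already lie in one of them. *)
Lemma noetherian_chain (S : nat -> set A) : noetherian A ->
  exists k, forall j, S j `<=` ideal_gen (\bigcup_(i in `I_k) S i).
Proof.
move=> /(_ _ (ideal_gen_ideal (\bigcup_i S i)))[s Is].
pose I k := ideal_gen (\bigcup_(i in `I_k) S i).
have Imono k l : (k <= l)%N -> I k `<=` I l.
  move=> lekl; apply: ideal_gen_sub => x [i /= ltik Six].
  by apply: ideal_gen_in; exists i => //=; apply: leq_trans lekl.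
have idU : is_ideal (\bigcup_k I k).
  split=> [|x y [k _ Ix] [l _ Iy]|r x [k _ Ix]].
  - by exists 0%N => //; apply: ideal_gen0.
  - exists (maxn k l) => //; apply: ideal_genD.
      by apply: Imono Ix; apply: leq_maxl.
    by apply: Imono Iy; apply: leq_maxr.
  - by exists k => //; apply: ideal_genMl.
have sU : [set` s] `<=` \bigcup_k I k.
  move=> x sx; suff: ideal_gen (\bigcup_i S i) x.
    apply: ideal_gen_min => // y [i _ Siy]; exists i.+1 => //.
    by apply: ideal_gen_in; exists i => /=.
  by rewrite Is; apply: ideal_gen_in.
have [k sk] : exists k, forall x, x \in s -> I k x.
  elim: s sU {Is} => [|x s IHs] sU; first by exists 0%N.
  have [k sk] : exists k, forall x, x \in s -> I k x.
    by apply: IHs => y /= ys; apply: sU => /=; rewrite inE ys orbT.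
  have [|l _ Ix] := sU x; first by rewrite /= mem_head.
  exists (maxn k l) => y; rewrite inE => /orP[/eqP->|/sk].
    by apply: Imono Ix; apply: leq_maxr.
  by apply: Imono; apply: leq_maxl.
exists k => j x Sjx.
have : ideal_gen (\bigcup_i S i) x by apply: ideal_gen_in; exists j.
by rewrite Is; apply: ideal_gen_sub.
Qed.

End Ideals.

(** * Homogeneous components *)

Section Grading.
Variables (n : nat) (A : idomainType) (G : 'rV[int]_n -> set A).
Hypothesis gradedA : is_grading G.

Lemma grading0 a : G a 0.
Proof. by case: gradedA => /(_ a)[]. Qed.

Lemma gradingB a x y : G a x -> G a y -> G a (x - y).
Proof. by case: gradedA => /(_ a)[_ +] _ _; apply. Qed.

Lemma gradingD a x y : G a x -> G a y -> G a (x + y).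
Proof.
move=> Gx Gy; rewrite -[y]opprK; apply: gradingB => //.
by rewrite -sub0r; apply: gradingB => //; apply: grading0.
Qed.

Lemma gradingM a b x y : G a x -> G b y -> G (a + b) (x * y).
Proof. by case: gradedA => _ + _; apply. Qed.

Definition is_decomposition x (f : 'rV[int]_n -> A) :=
  [/\ finite_set [set a | f a != 0], forall a, G a (f a)
    & x = \sum_(a \in [set: 'rV[int]_n]) f a].

(** The default of [xget] never occurs, since every element has a decomposition. *)
Definition component x : 'rV[int]_n -> A := xget (fun=> 0) (is_decomposition x).

Lemma componentP x : is_decomposition x (component x).
Proof.
by case: gradedA => _ _ /(_ x)[f [fP _]]; exact: (@xgetI _ _ (is_decomposition x) f).
Qed.

Lemma component_uniq x f : is_decomposition x f -> component x = f.
Proof.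
case: gradedA => _ _ /(_ x)[g [_ guniq]] fP.
by rewrite -(guniq _ (componentP x)) (guniq _ fP).
Qed.

Lemma component_in x a : G a (component x a).
Proof. by case: (componentP x). Qed.

Lemma component_homogeneous a x : G a x -> component x a = x.
Proof.
move=> Gx; rewrite (@component_uniq x (fun b => if b == a then x else 0)).
  by rewrite eqxx.
split.
- apply: (sub_finite_set (B := [set a])) => [b /=|]; last exact: finite_set1.
  by have [->//|] := eqVneq b a; rewrite eqxx.
- by move=> b; case: eqP => [->//|_]; apply: grading0.
- rewrite -(fsbig_widen [set a] setT) => [||b [_ /= ab]] //.
    by rewrite fsbig_set1 eqxx.
  by rewrite /preimage/=; have [/ab|] := eqVneq b a.
Qed.

Lemma componentD x y : component (x + y) = fun a => component x a + component y a.
Proof.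
apply: component_uniq.
have [fx Gx ex] := componentP x; have [fy Gy ey] := componentP y.
pose U := [set a | component x a != 0] `|` [set a | component y a != 0].
have Ufin : finite_set U by rewrite finite_setU.
have sumU (f : 'rV[int]_n -> A) : (forall a, f a != 0 -> U a) ->
    \sum_(a \in [set: 'rV[int]_n]) f a = \sum_(a \in U) f a.
  move=> fU; rewrite -(fsbig_widen U setT) // => a [_ /= NUa].
  by apply/eqP/negPn/negP => /fU.
have supp_xy a : component x a + component y a != 0 -> U a.
  rewrite /U /=; have [->|] := eqVneq (component x a) 0; last by left.
  by rewrite add0r; right.
split.
- exact: sub_finite_set Ufin.
- by move=> a; apply: gradingD.
- rewrite (sumU _ supp_xy) fsbig_split //= -!sumU -?ex -?ey // => a.
    by right.
  by left.
Qed.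

Lemma component0 : component 0 = fun=> 0.
Proof.
apply: component_uniq; split=> [|a|].
- by rewrite (_ : [set _ | _] = set0) // -subset0 => a /=; rewrite eqxx.
- exact: grading0.
- by rewrite fsbig1.
Qed.

Lemma componentMr x b z : G b z ->
  component (x * z) = fun a => component x (a - b) * z.
Proof.
move=> Gz; apply: component_uniq; have [fx Gx ex] := componentP x.
split.
- apply: (sub_finite_set (B := (fun a => a + b) @` [set a | component x a != 0])).
    move=> a /= xz0; exists (a - b); last by rewrite subrK.
    by apply: contraNneq xz0 => ->; rewrite mul0r.
  exact: finite_image.
- by move=> a; rewrite -{1}[a](subrK b); apply: gradingM.
- rewrite (reindex_fsbigT (fun a => a + b)) /=.
    under eq_fsbigr do rewrite addrK.
    by rewrite -mulr_fsuml -ex.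
  by exists (fun a => a - b) => a; rewrite (addrK, subrK).
Qed.

Lemma component_sum (T : Type) (s : seq T) (F : T -> A) a :
  component (\sum_(p <- s) F p) a = \sum_(p <- s) component (F p) a.
Proof.
elim: s => [|p s IHs]; first by rewrite !big_nil component0.
by rewrite !big_cons componentD IHs.
Qed.

(** Taking components of degree [b] in a combination of generators of degrees [d] replaces each
    coefficient by its component of degree [b - d]. *)
Lemma homogeneous_ideal_gen (D : set 'rV[int]_n) b y : G b y ->
  ideal_gen (\bigcup_(d in D) G d) y ->
  ideal_gen [set x | exists d u v, [/\ D d, G d u, G (b - d) v & x = u * v]] y.
Proof.
move=> Gy /ideal_gen_sum[s [sD ey]].
rewrite -(component_homogeneous Gy) ey component_sum big_seq.
elim/big_ind: _ => [|u v|[r z] /sD[d Dd /= Gz]]; first exact: ideal_gen0.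
  exact: ideal_genD.
apply: ideal_gen_in; exists d, z, (component r (b - d)).
by split=> //; [exact: component_in|rewrite (componentMr _ Gz) mulrC].
Qed.

End Grading.

(** * A form of Dickson's lemma for integer vectors *)

Lemma nondecreasing_subsequence (Q : nat -> Prop) (v : nat -> nat) :
  (forall k, exists p, (k <= p)%N /\ Q p) ->
  exists g : nat -> nat, [/\ forall i, (g i < g i.+1)%N, forall i, Q (g i)
    & forall i j, (i < j)%N -> (v (g i) <= v (g j))%N].
Proof.
move=> Qinf.
(* [h k] minimizes [v] among the indices from [k] on that satisfy [Q], so each chosen value bounds
   all later ones from below. *)
have /choice[h hP] k : exists p, [/\ (k <= p)%N, Q p &
    forall q, (k <= q)%N -> Q q -> (v p <= v q)%N].
  have ex : exists m, `[< exists p, [/\ (k <= p)%N, Q p & v p = m] >].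
    by have [p [kp Qp]] := Qinf k; exists (v p); apply/asboolP; exists p.
  have [_ /asboolP[p [kp Qp <-]] pmin] := ex_minnP ex.
  by exists p; split=> // q kq Qq; apply: pmin; apply/asboolP; exists q.
pose g := fix g i := if i is i'.+1 then h (g i').+1 else h 0%N.
have gS i : (g i < g i.+1)%N by have [] := hP (g i).+1.
exists g; split=> // [[|i] /=|i j ltij].
- by case: (hP 0%N).
- by case: (hP (g i).+1).
- have Qg k : Q (g k) by case: k => [|k] /=; [case: (hP 0%N)|case: (hP (g k).+1)].
  have ltg := homo_ltn ltn_trans gS ltij.
  case: i ltij ltg => [|i] ltij ltg /=.
    by case: (hP 0%N) => _ _; apply.
  case: (hP (g i).+1) => _ _; apply => //.
  by apply: ltn_trans ltg; apply: gS.
Qed.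

(* Unlike the coordinatewise order of Z^n, [dominated] is a well-quasi-order,
   and the l^1 norm is additive along [b = d + (b - d)] when [dominated d b]. *)
Definition dominated1 (b c : int) := (0 <= b <= c) || (c <= b <= 0).

Definition dominated n (b c : 'rV[int]_n) := forall j, dominated1 (b 0 j) (c 0 j).

Lemma dominated1_subsequence (u : nat -> int) :
  exists g : nat -> nat, (forall i, (g i < g i.+1)%N) /\
    forall i j, (i < j)%N -> dominated1 (u (g i)) (u (g j)).
Proof.
(* Either infinitely many terms are nonnegative or all are negative from [K] on; within one sign,
   [dominated1] compares absolute values. *)
have [u_ge0|/existsNP[K /forallNP u_lt0]] :=
    pselect (forall k, exists p, (k <= p)%N /\ 0 <= u p).
  have [g [gS gQ gv]] := nondecreasing_subsequence (fun p => absz (u p)) u_ge0.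
  exists g; split=> // i j ltij; have := gv _ _ ltij.
  by have := gQ i; have := gQ j; rewrite /dominated1; lia.
have u_le0 k : exists p, (k <= p)%N /\ u p <= 0.
  exists (k + K)%N; split; first exact: leq_addr.
  rewrite leNgt; apply/negP => /ltW u0.
  by apply: (u_lt0 (k + K)%N); rewrite leq_addl.
have [g [gS gQ gv]] := nondecreasing_subsequence (fun p => absz (u p)) u_le0.
exists g; split=> // i j ltij; have := gv _ _ ltij.
by have := gQ i; have := gQ j; rewrite /dominated1; lia.
Qed.

(** Coordinates are treated one at a time: passing to a further subsequence keeps domination in the
    earlier ones. *)
Lemma dominated_subsequence n (b : nat -> 'rV[int]_n) :
  exists g : nat -> nat, (forall i, (g i < g i.+1)%N) /\
    forall i j, (i < j)%N -> dominated (b (g i)) (b (g j)).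
Proof.
suff [g [gS gb]] : exists g : nat -> nat, (forall i, (g i < g i.+1)%N) /\
    forall k, k \in enum 'I_n -> forall i j, (i < j)%N ->
      dominated1 (b (g i) 0 k) (b (g j) 0 k).
  by exists g; split=> // i j ltij k; apply: gb => //; rewrite mem_enum.
elim: (enum _) => [|k s [g [gS gs]]]; first by exists id; split.
have [h [hS hk]] := dominated1_subsequence (fun i => b (g i) 0 k).
exists (g \o h); split=> [i|l]; first exact: (homo_ltn ltn_trans gS).
rewrite inE => /orP[/eqP->|ls] i j ltij /=; first exact: hk.
by apply: gs => //; apply: (homo_ltn ltn_trans hS).
Qed.

(** * Finitely many degrees generate up to monomials *)

Section FiniteGeneration.
Variables (n : nat) (A : idomainType) (G : 'rV[int]_n -> set A).
Hypotheses (gradedA : is_grading G) (noetherianA : noetherian A).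

(** Domination makes the norms of [d] and [b - d] add up to that of [b], so both factors have
    smaller norm. *)
Definition decomposable_part (b : 'rV[int]_n) : set A :=
  [set x | exists d u v,
    [/\ d != 0, d != b & dominated d b] /\ [/\ G d u, G (b - d) v & x = u * v]].

Definition indecomposable : set 'rV[int]_n :=
  [set b | b != 0 /\ ~ (G b `<=` ideal_gen (decomposable_part b))].

(** In an infinite sequence of distinct indecomposable degrees, pass to a dominated subsequence. By
    the chain condition some component lies in the ideal generated by the earlier ones, which
    decomposes its degree. *)
Lemma finite_indecomposable : finite_set indecomposable.
Proof.
apply: contrapT => /infiniteP/card_leP[f].
pose b i := val (f (SigSub (mem_set (I : [set: nat] i)))).
have bE i : indecomposable (b i) by apply/set_mem/valP.
have b_inj i j : b i = b j -> i = j.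
  by move=> /val_inj bij; have /(congr1 val) := in2TT 'inj_f _ _ bij.
have [g [gS gdom]] := dominated_subsequence b.
have [k sk] := noetherian_chain (fun i => G (b (g i))) noetherianA.
have [_ ] := bE (g k); apply => y Gy.
have Dk : ideal_gen (\bigcup_(d in [set b (g i) | i in `I_k]) G d) y.
  apply: ideal_gen_sub (sk k y Gy) => x [i ik Gx].
  by apply: ideal_gen_in; exists (b (g i)) => //; exists i.
apply: ideal_gen_sub (homogeneous_ideal_gen gradedA Gy Dk).
move=> _ [_ [u [v [[i /= ik <-] Gu Gv ->]]]]; apply: ideal_gen_in.
exists (b (g i)), u, v; split; split=> //.
- by case: (bE (g i)).
- apply/eqP => /b_inj egik; have := homo_ltn ltn_trans gS ik.
  by rewrite egik ltnn.
- exact: gdom.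
Qed.

Definition degree_norm (b : 'rV[int]_n) : nat := (\sum_j absz (b 0 j)%R)%N.

Lemma degree_norm_dominated (d b : 'rV[int]_n) :
  dominated d b -> degree_norm b = (degree_norm d + degree_norm (b - d))%N.
Proof.
move=> ddom; rewrite /degree_norm -big_split; apply: eq_bigr => j _ /=.
have := ddom j; rewrite !mxE /dominated1. move: (b 0 j) (d 0 j) => x y; lia.
Qed.

Lemma degree_norm_gt0 (d : 'rV[int]_n) : d != 0 -> (0 < degree_norm d)%N.
Proof.
apply: contraNltn; rewrite leqn0 sum_nat_eq0 => /forallP d0.
by apply/eqP/rowP => j; rewrite mxE; apply/eqP; rewrite -absz_eq0; apply: d0.
Qed.

(* The monomials of degree [b] in homogeneous elements of the degrees [d i],
   up to multiplication: only their support and degree matter here. *)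
Definition monomial_multiples N (d : 'I_N -> 'rV[int]_n) (b : 'rV[int]_n) : set A :=
  [set z | exists m : 'I_N -> nat, b = \sum_i d i *+ m i /\
     forall i, (0 < m i)%N -> exists2 y, G (d i) y & exists w, z = w * y].

Lemma monomial_multiplesM N (d : 'I_N -> 'rV[int]_n) b c u v :
  monomial_multiples d b u -> monomial_multiples d c v ->
  monomial_multiples d (b + c) (u * v).
Proof.
move=> [m [-> mu]] [l [-> lv]]; exists (fun i => m i + l i)%N; split.
  by rewrite -big_split; apply: eq_bigr => i _; rewrite mulrnDr.
move=> i; rewrite addn_gt0 => /orP[/mu[y Gy [w ->]]|/lv[y Gy [w ->]]].
  by exists y => //; exists (w * v); rewrite mulrAC.
by exists y => //; exists (u * w); rewrite mulrA.
Qed.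

(** Induction on the norm: an indecomposable degree is itself some [d i], and in any other nonzero
    degree the elements come from products of factors of smaller norm, whose monomials multiply. *)
Lemma finitely_generated : exists N (d : 'I_N -> 'rV[int]_n),
  (forall i, G (d i) <> [set 0]) /\
  forall b, G b `<=` ideal_gen (monomial_multiples d b).
Proof.
have /finite_seqP[E EP] := finite_indecomposable.
exists (size E), (tnth (in_tuple E)); split.
  move=> i Gi; have := mem_tnth i (in_tuple E).
  change ([set` E] (tnth (in_tuple E) i) -> False).
  rewrite -EP => -[_]; apply; rewrite Gi => _ ->; exact: ideal_gen0.
set d := tnth _ => b.
have [k] := ubnP (degree_norm b); elim: k b => // k IHk b ltbk y Gby.
have [b0|b_neq0] := eqVneq b 0.
  (* The empty monomial has degree zero and imposes no divisibility on [y]. *)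
  apply: ideal_gen_in; exists (fun=> 0%N); split=> //.
  by rewrite big1 // => i _; rewrite mulr0n.
have [bE|bNE] := pselect (b \in E).
  have [i bi] : exists i, b = d i by apply/tnthP.
  apply: ideal_gen_in; exists (fun j => (j == i) : nat); split.
    by rewrite (bigD1 i) //= eqxx mulr1n -bi big1 ?addr0 // => j /negPf->.
  move=> j; case: eqP => // -> _; exists y; first by rewrite -bi.
  by exists 1; rewrite mul1r.
have : ideal_gen (decomposable_part b) y.
  apply: contrapT => Ny; apply: bNE; change ([set` E] b); rewrite -EP.
  by split=> // /(_ y Gby).
apply: ideal_gen_sub => _ [c [u [v [[c0 cb cdom] [Gu Gv ->]]]]].
have bc0 : b - c != 0 by rewrite subr_eq0 eq_sym.
have := degree_norm_gt0 c0; have := degree_norm_gt0 bc0.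
have := degree_norm_dominated cdom => eb bc_gt0 c_gt0.
apply: (@ideal_gen_mul _ (monomial_multiples d c) (monomial_multiples d (b - c))).
- move=> u' v' mu mv; apply: ideal_gen_in.
  by rewrite -[b](subrKC c); apply: monomial_multiplesM.
- by apply: IHk Gu; lia.
- by apply: IHk Gv; lia.
Qed.

End FiniteGeneration.

(** * Walls, Caratheodory's theorem and rational combinations *)

Section Support.
Variables (K : fieldType) (N n : nat).
Implicit Types (F : {set 'I_N}) (M : 'M[K]_(N, n)).

(** Rows outside [F] are zeroed rather than deleted, so that the matrix size does not depend on
    [F]. *)
Definition row_restrict F M := \matrix_(i, j) (if i \in F then M i j else 0).

Definition mask F (v : 'rV[K]_N) := \row_i (if i \in F then v 0 i else 0).

Lemma mul_row_restrict F M (v : 'rV_N) : v *m row_restrict F M = mask F v *m M.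
Proof.
apply/rowP => j; rewrite !mxE; apply: eq_bigr => i _.
by rewrite !mxE; case: ifP; rewrite ?mulr0 ?mul0r.
Qed.

(* For [F] spanning a hyperplane of the row space of [M], the nonzero
   restrictions to that space of these functionals define the hyperplane. *)
Definition wall_functional M F (j : 'I_n) : 'cV[K]_n :=
  col j (cokermx (row_restrict F M)).

Lemma wall_functional_entry M F j i :
  (M *m wall_functional M F j) i 0 = (row i M *m cokermx (row_restrict F M)) 0 j.
Proof.
rewrite mxE [RHS]mxE; apply: eq_bigr => k _.
by rewrite [row _ _ _ _]mxE [col _ _ _ _]mxE.
Qed.

Lemma wall_functional0 M F j i :
  i \in F -> (M *m wall_functional M F j) i 0 = 0.
Proof.
move=> iF; rewrite wall_functional_entry.
suff -> : row i M = row i (row_restrict F M) by rewrite -row_mul mulmx_coker !mxE.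
by apply/rowP => k; rewrite !mxE iF.
Qed.

Lemma wall_functional_neq0 M F i : ~~ (row i M <= row_restrict F M)%MS ->
  exists j, (M *m wall_functional M F j) i 0 != 0.
Proof.
rewrite submxE => /eqP neq0; apply: contrapT => /forallNP eq0; apply: neq0.
apply/rowP => j; rewrite [RHS]mxE -wall_functional_entry.
by apply/eqP/negPn/negP/eq0.
Qed.

(** All rows of [F] other than [i] are killed, so the functional reads off the coefficient at [i] up
    to a factor independent of [v]. *)
Lemma wall_functional_supp M F j i (v : 'rV_N) : (forall k, v 0 k != 0 -> k \in F) ->
  (v *m M *m wall_functional M (F :\ i)%SET j) 0 0 =
  v 0 i * (M *m wall_functional M (F :\ i)%SET j) i 0.
Proof.
move=> vF; rewrite -mulmxA mxE (bigD1 i) //= big1 ?addr0 // => k ki.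
have [->|/vF kF] := eqVneq (v 0 k) 0; first by rewrite mul0r.
by rewrite (@wall_functional0 _ _ _ k) ?mulr0 // !inE ki.
Qed.

End Support.

Lemma map_row_restrict (K K' : fieldType) (f : {rmorphism K -> K'}) N n
    (F : {set 'I_N}) (M : 'M[K]_(N, n)) :
  map_mx f (row_restrict F M) = row_restrict F (map_mx f M).
Proof. by apply/matrixP => i j; rewrite !mxE; case: ifP; rewrite ?rmorph0. Qed.

Lemma map_wall_functional (K K' : fieldType) (f : {rmorphism K -> K'}) N n
    (F : {set 'I_N}) (M : 'M[K]_(N, n)) j :
  map_mx f (wall_functional M F j) = wall_functional (map_mx f M) F j.
Proof. by rewrite /wall_functional map_col map_cokermx map_row_restrict. Qed.

Definition pos_support (K : numDomainType) N (m : 'rV[K]_N) : {set 'I_N} :=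
  finset (fun i => 0 < m 0 i).

(** Induction on the size of the support: while some row depends on the others in the support,
    moving along that relation kills a coefficient and keeps the rest nonnegative. *)
Lemma caratheodory (K : realFieldType) N n (M : 'M[K]_(N, n)) (m : 'rV[K]_N) :
  (forall i, 0 <= m 0 i) ->
  exists m' : 'rV[K]_N,
    [/\ forall i, 0 <= m' 0 i, m' *m M = m *m M,
        forall i, 0 < m' 0 i -> 0 < m 0 i
      & forall i, 0 < m' 0 i ->
          ~~ (row i M <= row_restrict (pos_support m' :\ i)%SET M)%MS].
Proof.
have [k] := ubnP #|pos_support m|.
elim: k m => // k IHk m ltmk m_ge0.
set F := pos_support m in ltmk.
have [|/existsNP[i /not_implyP[mi_gt0 /negP/negPn/submxP[D eiD]]]] :=
    pselect (forall i, 0 < m 0 i -> ~~ (row i M <= row_restrict (F :\ i)%SET M)%MS).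
  by move=> indep; exists m.
(* The dependence of row [i] on the others, as a relation [u] supported in [F] with entry 1 at
   [i]. *)
pose u := delta_mx 0 i - mask (F :\ i)%SET D.
have uM : u *m M = 0.
  by rewrite mulmxBl -rowE -mul_row_restrict -eiD subrr.
have ui : u 0 i = 1 by rewrite !mxE !inE !eqxx subr0.
have uF j : 0 < u 0 j -> 0 < m 0 j.
  rewrite !mxE !inE; have [->|_] /= := eqVneq j i; first by [].
  by case: ifP => //; rewrite subrr ltxx.
have uF0 j : m 0 j = 0 -> u 0 j = 0.
  move=> mj0; rewrite !mxE !inE mj0 ltxx andbF subr0.
  by have [eji|//] := eqVneq j i; rewrite -eji mj0 ltxx in mi_gt0.
have ui_gt0 : 0 < u 0 i by rewrite ui.
(* [k0] is the first coefficient of [m - t *: u] to vanish as [t] grows from 0. *)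
pose k0 := [arg min_(k < i | 0 < u 0 k) (m 0 k / u 0 k)]%O.
have [uk0 k0min] : 0 < u 0 k0 /\ forall j, 0 < u 0 j ->
    m 0 k0 / u 0 k0 <= m 0 j / u 0 j.
  by rewrite /k0; case: arg_minP.
pose t := m 0 k0 / u 0 k0.
have t_ge0 : 0 <= t by rewrite divr_ge0 // ltW.
pose m1 := m - t *: u.
have m1E j : m1 0 j = m 0 j - t * u 0 j by rewrite !mxE.
have m1_ge0 j : 0 <= m1 0 j.
  rewrite m1E subr_ge0; have [uj_gt0|uj_le0] := ltP 0 (u 0 j).
    by rewrite -ler_pdivlMr //; apply: k0min.
  by apply: le_trans (m_ge0 j); rewrite mulr_ge0_le0.
have m1M : m1 *m M = m *m M by rewrite mulmxBl -scalemxAl uM scaler0 subr0.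
have m1F j : 0 < m1 0 j -> 0 < m 0 j.
  move=> m1j; rewrite lt0r m_ge0 andbT; apply: contraTneq m1j => mj0.
  by rewrite m1E mj0 uF0 // mulr0 subrr ltxx.
have m1k0 : m1 0 k0 = 0 by rewrite m1E divfK ?subrr // gt_eqF.
have [|//|m' [m'_ge0 m'M m'F indep]] := IHk m1.
  rewrite -ltnS; apply: leq_trans ltmk; rewrite ltnS.
  apply: proper_card; apply/properP; split.
    by apply/fintype.subsetP => j; rewrite !inE; apply: m1F.
  by exists k0; rewrite !inE ?m1k0 ?ltxx //; apply: uF.
exists m'; split=> //; first by rewrite m'M.
by move=> j /m'F/m1F.
Qed.

(* By Caratheodory, [x] is a positive combination of independent rows. As [x]
   is on no wall these rows span, and the walls through all of them but one
   give the signs of the coefficients of [y]. *)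
Lemma same_side_combination (R : realType) N n (M : 'M[rat]_(N, n))
    (m : 'rV[R]_N) (y : 'rV[rat]_n) :
  (forall i, 0 <= m 0 i) -> (y <= M)%MS ->
  (forall F j, M *m wall_functional M F j != 0 ->
     0 < (m *m map_mx ratr M *m map_mx ratr (wall_functional M F j)) 0 0 *
         ratr ((y *m wall_functional M F j) 0 0)) ->
  exists c : 'rV[rat]_N, [/\ forall i, 0 <= c 0 i,
    forall i, 0 < c 0 i -> 0 < m 0 i & c *m M = y].
Proof.
move=> m_ge0 yM same_side; set MR := map_mx ratr M in same_side.
have [m' [m'_ge0 m'M m'm indepR]] := caratheodory MR m_ge0.
set F := pos_support m' in indepR.
have m'F k : m' 0 k != 0 -> k \in F by rewrite inE lt0r m'_ge0 andbT.
have indep i : i \in F -> ~~ (row i M <= row_restrict (F :\ i)%SET M)%MS.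
  rewrite inE => /indepR; apply: contra.
  by rewrite -(map_submx (@ratr R)) map_row map_row_restrict.
(* Otherwise a functional vanishing on [F] but not on all rows would vanish at the real point,
   contradicting the strict inequality. *)
have spanning : (M <= row_restrict F M)%MS.
  apply/row_subP => i; apply: contraT => /wall_functional_neq0[j lij].
  have /same_side : M *m wall_functional M F j != 0.
    by apply: contraNneq lij => ->; rewrite mxE.
  rewrite -m'M -mulmxA -map_mxM mxE big1 ?mul0r ?ltxx // => k _.
  have [->|/m'F kF] := eqVneq (m' 0 k) 0; first by rewrite mul0r.
  by rewrite mxE wall_functional0 // rmorph0 mulr0.
have [D yD] := submxP (submx_trans yM spanning).
have cF k : mask F D 0 k != 0 -> k \in F.
  by rewrite mxE; case: ifP => //; rewrite eqxx.
exists (mask F D); rewrite -mul_row_restrict -yD.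
suff c_gt0 i : i \in F -> 0 < mask F D 0 i.
  split=> // i; last first.
    by rewrite lt0r => /andP[/cF]; rewrite inE => /m'm.
  by have [/c_gt0/ltW//|iNF] := boolP (i \in F); rewrite mxE (negPf iNF).
move=> iF; have [j lij] := wall_functional_neq0 (indep i iF).
have /same_side : M *m wall_functional M (F :\ i)%SET j != 0.
  by apply: contraNneq lij => ->; rewrite mxE.
(* The two pairings are the coefficients of the two points at [i] times one common nonzero factor.
   Its square is positive, so the coefficients have the same sign. *)
rewrite -m'M map_wall_functional wall_functional_supp //.
rewrite yD mul_row_restrict wall_functional_supp // -map_wall_functional.
rewrite -map_mxM [X in _ * X * _]mxE rmorphM /=.
rewrite inE in iF; rewrite mulrACA pmulr_lgt0; last first.
  by rewrite -expr2 exprn_even_gt0 //= fmorph_eq0.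
by rewrite pmulr_rgt0 // ltr0q.
Qed.

Lemma common_denominator N (c : 'rV[rat]_N) : (forall i, 0 <= c 0 i) ->
  exists D (k : 'I_N -> nat), (0 < D)%N /\ forall i, (k i)%:R = D%:R * c 0 i.
Proof.
move=> c_ge0; pose D i := absz (denq (c 0 i)).
have D_gt0 i : (0 < D i)%N by rewrite absz_gt0 denq_neq0.
exists (\prod_i D i)%N.
exists (fun i => (\prod_(j | j != i) D j * absz (numq (c 0%R i)))%N).
split=> [|i]; first exact: prodn_gt0.
rewrite [in RHS](bigD1 i) //= natrM [in RHS]natrM mulrAC mulrC; congr (_ * _).
rewrite -[c 0 i in RHS]divq_num_den mulrCA.
have -> : (D i)%:R = (denq (c 0 i))%:~R :> rat.
  by rewrite pmulrn absz_denq.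
rewrite divff ?mulr1; last by rewrite intr_eq0 denq_neq0.
by rewrite pmulrn gez0_abs // numq_ge0.
Qed.

(** * Points in general position with respect to finitely many linear forms *)

Section Walls.
Variables (R : realType) (n : nat) (P : finType) (l : P -> 'cV[R]_n).
Implicit Types (v w : 'rV[R]_n) (C : set 'rV[R]_n).

Lemma pairingD v w (h : 'cV[R]_n) :
  ((v + w) *m h) 0 0 = (v *m h) 0 0 + (w *m h) 0 0.
Proof. by rewrite mulmxDl [LHS]mxE. Qed.

Lemma pairingZ t v (h : 'cV[R]_n) : ((t *: v) *m h) 0 0 = t * (v *m h) 0 0.
Proof. by rewrite -scalemxAl [LHS]mxE. Qed.

(** A multiple of [v] exceeding the sum of all ratios of absolute values outweighs [w] on each form
    that does not vanish at [v]. *)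
Lemma dominant_multiple v w : exists2 t : R, 0 < t & forall p,
  (v *m l p) 0 0 != 0 -> 0 < (v *m l p) 0 0 * ((t *: v + w) *m l p) 0 0.
Proof.
pose r p := `|(w *m l p) 0 0| / `|(v *m l p) 0 0|.
have r_ge0 p : 0 <= r p by rewrite divr_ge0.
exists (1 + \sum_p r p) => [|p vp_neq0].
  by rewrite ltr_wpDr // sumr_ge0.
rewrite pairingD pairingZ; set x := (v *m l p) 0 0 in vp_neq0 *.
set z := (w *m l p) 0 0; set t := 1 + _.
have ltzx : `|z| < t * `|x|.
  rewrite -ltr_pdivrMr ?normr_gt0 // /t (bigD1 p) //= -/(r p).
  have : 0 <= \sum_(q | q != p) r q by apply: sumr_ge0.
  by lra.
have: `|x| * `|z| < `|x| * (t * `|x|) by rewrite ltr_pM2l ?normr_gt0.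
rewrite mulrCA -expr2 real_normK ?num_real // -normrM.
have := ler_norm (- (x * z)); rewrite normrN; nra.
Qed.

(** Forms are handled one by one: if [u] lies on the new wall, add a row off it to a large multiple
    of [u], which preserves the signs already obtained. *)
Lemma generic_point N (M : 'M[R]_(N, n)) C :
  (forall v w, C v -> C w -> C (v + w)) ->
  (forall (t : R) v, 0 <= t -> C v -> C (t *: v)) ->
  C 0 -> (forall i, C (row i M)) ->
  exists2 u, C u & forall p, M *m l p != 0 -> (u *m l p) 0 0 != 0.
Proof.
move=> CD CZ C0 Crow.
suff [u Cu lu] : exists2 u, C u & forall p, p \in enum P ->
    M *m l p != 0 -> (u *m l p) 0 0 != 0.
  by exists u => // p; apply: lu; rewrite mem_enum.
elim: (enum P) => [|p s [u Cu lu]]; first by exists 0.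
have [[p0|up]|] := pselect (M *m l p = 0 \/ (u *m l p) 0 0 != 0).
- by exists u => // q; rewrite inE => /orP[/eqP->|/lu//]; rewrite p0 eqxx.
- by exists u => // q; rewrite inE => /orP[/eqP->|/lu//].
move=> /not_orP[/eqP lp /negP/negPn/eqP up].
have [i Mi] : exists i, (M *m l p) i 0 != 0.
  apply: contrapT => /forallNP Mp; move/eqP: lp; apply.
  by apply/colP => i; rewrite [RHS]mxE; apply/eqP/negPn/negP.
have [t t_gt0 tP] := dominant_multiple u (row i M).
exists (t *: u + row i M); first by apply: CD => //; apply: CZ => //; apply: ltW.
move=> q; rewrite inE => /orP[/eqP-> _|qs lq].
  by rewrite pairingD pairingZ up mulr0 add0r -row_mul mxE.
by have := tP q (lu q qs lq); apply: contraTneq => ->; rewrite mulr0 ltxx.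
Qed.

End Walls.

(** * Differences of a cone and its relative interior *)

Section ConeDiff.
Variables (R : realType) (n : nat) (s : set 'rV[R]_n).
Hypothesis cone_s : is_cone s.

Lemma cone_diffD x y : cone_diff s x -> cone_diff s y -> cone_diff s (x + y).
Proof.
case: cone_s => sD _ [a sa [b sb <-]] [c sc [e se <-]].
by exists (a + c); [exact: sD|exists (b + e); [exact: sD|rewrite opprD addrACA]].
Qed.

Lemma cone_diffZ t x : cone_diff s x -> cone_diff s (t *: x).
Proof.
case: cone_s => _ sZ [a sa [b sb <-]].
have [t_ge0|/ltW t_le0] := leP 0 t.
  by exists (t *: a); [exact: sZ|exists (t *: b); [exact: sZ|rewrite scalerBr]].
have Nt_ge0 : 0 <= - t by rewrite oppr_ge0.
exists (- t *: b); first exact: sZ.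
by exists (- t *: a); [exact: sZ|rewrite !scaleNr opprK scalerBr addrC].
Qed.

Lemma row_space_sub_cone_diff N (M : 'M[R]_(N, n)) v : s 0 ->
  (forall i, cone_diff s (row i M)) -> (v <= M)%MS -> cone_diff s v.
Proof.
move=> s0 srow /submxP[c ->]; rewrite mulmx_sum_row.
apply: (big_ind (cone_diff s)) => [||i _].
- by exists 0 => //; exists 0 => //; rewrite subr0.
- exact: cone_diffD.
- exact: cone_diffZ.
Qed.

End ConeDiff.

(** The points [x - t *: w] stay in the difference space and tend to [x] as [t] decreases to 0. *)
Lemma rel_int_shrink (R : realType) n (s : set 'rV[R]_n) x w :
  is_cone s -> rel_int s x -> s w ->
  exists2 t : R, 0 < t & s (x - t *: w).
Proof.
move=> [_ sZ] [sx xnear] sw.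
have cvgx : (fun t : R => x - t *: w) @ 0^'+ --> x.
  apply: cvg_at_right_filter; rewrite -[X in _ --> X]subr0 -[X in _ - X](scale0r w).
  by apply: cvgB; [exact: cvg_cst|exact: scalel_continuous].
have [t [t_gt0 txw]] : exists t : R,
    0 < t /\ (cone_diff s (x - t *: w) -> s (x - t *: w)).
  apply: (@filter_ex _ (0 : R)^'+); apply: filterI; first exact: nbhs_right_gt.
  exact: (cvgx _ xnear).
exists t => //; apply: txw; exists x => //; exists (t *: w) => //.
by apply: sZ => //; apply: ltW.
Qed.

(** * The degree cone in terms of the generating degrees *)

Section Chambers.
Variables (R : realType) (n : nat) (A : idomainType) (G : 'rV[int]_n -> set A).
Hypotheses (gradedA : is_grading G) (G1 : G 0 1).
Variables (N : nat) (d : 'I_N -> 'rV[int]_n).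
Hypothesis dG : forall i, G (d i) <> [set 0].
Hypothesis d_gen : forall b, G b `<=` ideal_gen (monomial_multiples G d b).

Lemma gradingX a y k : G a y -> G (a *+ k) (y ^+ k).
Proof.
move=> Gy; elim: k => [|k IHk]; first by rewrite mulr0n expr0.
by rewrite mulrS exprS; apply: gradingM.
Qed.

(** Divisibility by one element of each degree in the support is enough, since powers of [z] supply
    any exponents. *)
Lemma homogeneous_divisor (z : A) (k : 'I_N -> nat) :
  (forall i, (0 < k i)%N -> exists2 y, G (d i) y & exists w, z = w * y) ->
  exists y p w, G (\sum_i d i *+ k i) y /\ z ^+ p = w * y.
Proof.
move=> zP; elim: (index_enum _) => [|i s [y [p [w [Gy zw]]]]].
  by exists 1, 0%N, 1; rewrite big_nil expr0 mulr1.
rewrite big_cons; have [ki0|/zP[y' Gy' [w' zw']]] := posnP (k i).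
  by exists y, p, w; rewrite ki0 mulr0n add0r.
exists (y' ^+ k i * y), (k i + p)%N, (w' ^+ k i * w); split.
  by apply: gradingM => //; apply: gradingX.
by rewrite exprD zw {1}zw' exprMn mulrACA.
Qed.

Lemma homogeneous_neq0 (a : 'rV[int]_n) :
  G a <> [set 0] -> exists2 y, G a y & y != 0.
Proof.
move=> Ga; apply: contrapT => /forall2NP Gy; apply: Ga.
apply/seteqP; split=> [y Gay|_ ->]; last exact: grading0.
by case: (Gy y) => // /negP/negPn/eqP.
Qed.

(** Kept over the rationals so that walls are rational; [ratr] transports them to [R]. *)
Definition degree_mx : 'M[rat]_(N, n) := \matrix_i map_mx intr (d i).

Lemma row_degree_mx i : row i (map_mx ratr degree_mx) = of_int R (d i).
Proof. by apply/rowP => j; rewrite !mxE ratr_int. Qed.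

Lemma of_int_sum (k : 'I_N -> nat) :
  of_int R (\sum_i d i *+ k i) = (\row_i (k i)%:R) *m map_mx ratr degree_mx.
Proof.
rewrite mulmx_sum_row [LHS]raddf_sum; apply: eq_bigr => i _.
by rewrite row_degree_mx mxE scaler_nat [LHS]raddfMn.
Qed.

Lemma degree_coneP (v : 'rV[R]_n) : degree_cone R G v <->
  exists2 m : 'rV[R]_N, forall i, 0 <= m 0 i & v = m *m map_mx ratr degree_mx.
Proof.
split=> [[k [a [c [acP ->]]]]|[m m_ge0 ->]]; last first.
  exists N, d, (fun i => m 0 i); split=> //.
  by rewrite mulmx_sum_row; apply: eq_bigr => i _; rewrite row_degree_mx.
apply: (big_ind (fun w : 'rV[R]_n => exists2 m : 'rV[R]_N,
    forall i, 0 <= m 0 i & w = m *m map_mx ratr degree_mx)).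
- by exists 0 => [i|]; rewrite ?mul0mx // mxE.
- move=> _ _ [m m_ge0 ->] [m' m'_ge0 ->]; exists (m + m') => [i|].
    by rewrite mxE addr_ge0.
  by rewrite mulmxDl.
move=> i _; have [Ga c_ge0] := acP i.
have [y Gy y_neq0] := homogeneous_neq0 Ga.
(* If [a i] were no such sum, there would be no monomials of that degree and its component would be
   zero. *)
have [l al] : exists l : 'I_N -> nat, a i = \sum_j d j *+ l j.
  apply: contrapT => Nl; move/eqP: y_neq0; apply.
  apply: (ideal_gen_min (I := [set 0])) (d_gen Gy).
    split=> // [_ _ -> ->|r _ ->] /=; first by rewrite addr0.
    by rewrite mulr0.
  by move=> z [m [am _]]; case: Nl; exists m.
exists (c i *: \row_j (l j)%:R) => [j|].
  by rewrite !mxE mulr_ge0.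
by rewrite -scalemxAl al of_int_sum.
Qed.

Lemma degree_cone_is_cone : is_cone (degree_cone R G).
Proof.
split=> [x y /degree_coneP[m m_ge0 ->] /degree_coneP[m' m'_ge0 ->]|
         t x t_ge0 /degree_coneP[m m_ge0 ->]]; apply/degree_coneP.
  by exists (m + m') => [i|]; rewrite ?mulmxDl // mxE addr_ge0.
by exists (t *: m) => [i|]; rewrite ?scalemxAl // mxE mulr_ge0.
Qed.

Lemma degree_cone_row i : degree_cone R G (row i (map_mx ratr degree_mx)).
Proof.
apply/degree_coneP; exists (delta_mx 0 i) => [j|]; last by rewrite -rowE.
by rewrite mxE.
Qed.

Lemma degree_cone_rat (a : 'rV[rat]_n) :
  degree_cone R G (of_rat R a) -> (a <= degree_mx)%MS.
Proof.
move=> /degree_coneP[m _ am]; rewrite -(map_submx (@ratr R)).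
by apply/submxP; exists m.
Qed.

(** * Ray radicals depend only on the sides of the walls *)

Lemma rational_combination (a : 'rV[rat]_n) (c : 'rV[rat]_N) :
  (forall i, 0 <= c 0 i) -> c *m degree_mx = a ->
  exists k : 'I_N -> nat, (forall i, (0 < k i)%N -> 0 < c 0 i) /\
    exists2 t : R, 0 < t & of_int R (\sum_i d i *+ k i) = t *: of_rat R a.
Proof.
move=> c_ge0 <-; have [D [k [D_gt0 kP]]] := common_denominator c_ge0.
exists k; split=> [i|].
  by rewrite -(ltr0n rat) kP pmulr_rgt0 // ltr0n.
exists D%:R; first by rewrite ltr0n.
rewrite of_int_sum /of_rat map_mxM /= scalemxAl; congr (_ *m _).
apply/rowP => i; rewrite !mxE -[(k i)%:R](ratr_nat R) kP rmorphM /=.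
by rewrite ratr_nat.
Qed.

(** As the inequality is strict, [same_side a a] says that [a] lies on no wall. *)
Definition same_side (a b : 'rV[rat]_n) := forall F j,
  degree_mx *m wall_functional degree_mx F j != 0 ->
  0 < (a *m wall_functional degree_mx F j) 0 0 *
      (b *m wall_functional degree_mx F j) 0 0.

Lemma same_side_positive (a b : 'rV[rat]_n) (m : 'rV[R]_N) :
  (b <= degree_mx)%MS -> same_side a b ->
  (forall i, 0 <= m 0 i) -> of_rat R a = m *m map_mx ratr degree_mx ->
  exists k : 'I_N -> nat, (forall i, (0 < k i)%N -> 0 < m 0 i) /\
    exists2 t : R, 0 < t & of_int R (\sum_i d i *+ k i) = t *: of_rat R b.
Proof.
move=> bM ab m_ge0 am.
have [F j Fj|c [c_ge0 cm cb]] := same_side_combination m_ge0 bM.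
  rewrite -am /of_rat -map_mxM [X in X * _]mxE -rmorphM /= ltr0q; exact: ab.
have [k [kc kt]] := rational_combination c_ge0 cb.
by exists k; split=> // i /kc/cm.
Qed.

(** A monomial on the ray of [a] writes [a] as a positive combination of its support. Then [b] is
    one of a subset of that support, so a power of the monomial is a multiple of an element on the
    ray of [b]. *)
Lemma ray_radical_sub (a b : 'rV[rat]_n) :
  (b <= degree_mx)%MS -> same_side a b ->
  ray_radical R G a `<=` ray_radical R G b.
Proof.
move=> bM ab; apply: radical_idem_sub.
have idb : is_ideal (ray_ideal R G b) by exact: ideal_gen_ideal.
apply: radical_ideal_gen_sub => // y [c [t t_gt0 ct]] /d_gen.
apply: (radical_ideal_gen_sub idb) => z [m [cm zm]].
(* Dividing the exponents by [t] expresses [a] itself instead of the degree [c] on its ray. *)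
pose mR : 'rV[R]_N := t^-1 *: \row_i (m i)%:R.
have mR_ge0 i : 0 <= mR 0 i by rewrite !mxE mulr_ge0 // invr_ge0 ltW.
have [|k [km [u u_gt0 ku]]] := same_side_positive bM ab mR_ge0.
  by rewrite -scalemxAl -of_int_sum -cm ct scalerA mulVf ?scale1r ?gt_eqF.
have [|x [p [w [Gx zw]]]] := @homogeneous_divisor z k.
  by move=> i /km; rewrite !mxE pmulr_rgt0 ?invr_gt0 // ltr0n; apply: zm.
exists p; rewrite /= zw; apply: ideal_genMl; apply: ideal_gen_in.
by exists (\sum_i d i *+ k i) => //; exists u.
Qed.

(** A product of nonzero elements of all degrees [d i] is nonzero in a domain, and a power of it is
    a multiple of some [x] on the ray of [b]. *)
Lemma ray_radical_neq0 (b : 'rV[rat]_n) :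
  degree_cone R G (of_rat R b) -> same_side b b -> ray_radical R G b <> [set 0].
Proof.
move=> Cb bb J0; have bM := degree_cone_rat Cb.
have /degree_coneP[m m_ge0 bm] := Cb.
have [k [_ [t t_gt0 kt]]] := same_side_positive bM bb m_ge0 bm.
have /choice[y yP] i : exists y, G (d i) y /\ y != 0.
  by have [y] := homogeneous_neq0 (@dG i); exists y.
pose z := \prod_i y i.
have z_neq0 : z != 0 by apply/prodf_neq0 => i _; case: (yP i).
have [|x [p [w [Gx zw]]]] := @homogeneous_divisor z k.
  move=> i _; exists (y i); first by case: (yP i).
  by exists (\prod_(j | j != i) y j); rewrite /z (bigD1 i) //= mulrC.
have : ray_radical R G b x.
  exists 1%N; rewrite /= expr1; apply: ideal_gen_in.
  by exists (\sum_i d i *+ k i) => //; exists t.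
rewrite J0 => /= x0; have := expf_neq0 p z_neq0.
by rewrite zw x0 mulr0 eqxx.
Qed.

(** * The closed cells of the wall arrangement *)

Notation wall := ({set 'I_N} * 'I_n)%type.

Definition wall_form (p : wall) : 'cV[R]_n :=
  map_mx ratr (wall_functional degree_mx p.1 p.2).

Definition proper_wall (p : wall) := map_mx ratr degree_mx *m wall_form p != 0.

(** The bit [s p] is true on the nonpositive side of the wall [p]. *)
Definition cell (s : {ffun wall -> bool}) : set 'rV[R]_n :=
  [set v | degree_cone R G v /\
     forall p, proper_wall p -> 0 <= (-1) ^+ s p * (v *m wall_form p) 0 0].

Definition cell_interior (s : {ffun wall -> bool}) : set 'rV[R]_n :=
  [set v | degree_cone R G v /\
     forall p, proper_wall p -> 0 < (-1) ^+ s p * (v *m wall_form p) 0 0].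

Lemma cell_interior_sub s : cell_interior s `<=` cell s.
Proof. by move=> v [Cv sv]; split=> // p /sv/ltW. Qed.

Lemma cell_is_cone s : is_cone (cell s).
Proof.
have [CD CZ] := degree_cone_is_cone.
split=> [x y [Cx sx] [Cy sy]|t x t_ge0 [Cx sx]]; split.
- exact: CD.
- by move=> p pp; rewrite pairingD mulrDr addr_ge0 ?sx ?sy.
- exact: CZ.
- by move=> p pp; rewrite pairingZ mulrCA mulr_ge0 ?sx.
Qed.

Lemma cell_cover v : degree_cone R G v ->
  exists s, cell_interior s !=set0 /\ cell s v.
Proof.
move=> Cv; have [CD CZ] := degree_cone_is_cone.
have C0 : degree_cone R G 0 by rewrite -(scale0r v); apply: CZ.
have [u Cu uP] := generic_point wall_form CD CZ C0 degree_cone_row.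
have [t t_gt0 tP] := dominant_multiple wall_form v u.
pose ev (x : 'rV[R]_n) (p : wall) : R := (x *m wall_form p) 0 0.
(* The signs of [v], with those of the generic point [u] on walls through [v]; these are the signs
   of [t *: v + u]. *)
pose s : {ffun wall -> bool} :=
  [ffun p => if ev v p != 0 then ev v p < 0 else ev u p < 0].
exists s; split.
  exists (t *: v + u); split.
    by apply: CD => //; apply: CZ => //; apply: ltW.
  move=> p pp; rewrite ffunE.
  have [vp0|vp_neq0] := eqVneq (ev v p) 0; rewrite /= -/(ev (t *: v + u) p).
    have -> : ev (t *: v + u) p = ev u p.
      by rewrite /ev pairingD pairingZ -/(ev v p) vp0 mulr0 add0r.
    by rewrite -normrEsign normr_gt0; apply: uP.
  have := tP p vp_neq0; rewrite -/(ev v p) -/(ev (t *: v + u) p).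
  by rewrite {1}(numEsign (ev v p)) mulrAC mulrC pmulr_rgt0 // normr_gt0.
split=> // p pp; rewrite ffunE -/(ev v p).
have [->|vp0 /=] := eqVneq (ev v p) 0; first by rewrite mulr0.
by rewrite -normrEsign.
Qed.

Lemma degree_cone_sub (v : 'rV[R]_n) :
  degree_cone R G v -> (v <= map_mx ratr degree_mx)%MS.
Proof. by move=> /degree_coneP[m _ ->]; apply: submxMl. Qed.

Lemma cone_diff_row_space (s : set 'rV[R]_n) :
  is_cone s -> s `<=` degree_cone R G -> s 0 ->
  (forall i, cone_diff s (row i (map_mx ratr degree_mx))) ->
  cone_diff s = [set v | (v <= map_mx ratr degree_mx)%MS].
Proof.
move=> cone_s sC s0 srow; apply/seteqP; split=> [_ [x sx [y sy <-]]|v] /=.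
  by rewrite addmx_sub ?eqmx_opp ?degree_cone_sub //; apply: sC.
exact: row_space_sub_cone_diff.
Qed.

Lemma is_cone0 (s : set 'rV[R]_n) x : is_cone s -> s x -> s 0.
Proof. by move=> [_ sZ] sx; rewrite -(scale0r x); apply: sZ. Qed.

Lemma cone_diff_degree_cone :
  cone_diff (degree_cone R G) = [set v | (v <= map_mx ratr degree_mx)%MS].
Proof.
have C0 : degree_cone R G 0.
  by apply/degree_coneP; exists 0 => [i|]; rewrite ?mul0mx // mxE.
apply: cone_diff_row_space => // [|i]; first exact: degree_cone_is_cone.
by exists (row i (map_mx ratr degree_mx));
  [exact: degree_cone_row|exists 0; rewrite ?subr0].
Qed.

(** Adding a row to a large multiple of an interior point stays in the cell, so every row is a
    difference of two points of the cell. *)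
Lemma cone_diff_cell s : cell_interior s !=set0 ->
  cone_diff (cell s) = [set v | (v <= map_mx ratr degree_mx)%MS].
Proof.
move=> [w sw]; have cone_s := cell_is_cone s; have [CD CZ] := degree_cone_is_cone.
have sw' := cell_interior_sub sw; have [Cw wP] := sw.
apply: cone_diff_row_space => // [v []//||i]; first exact: is_cone0 sw'.
set e := row i _.
have [t t_gt0 tP] := dominant_multiple wall_form w e.
exists (t *: w + e); last first.
  by exists (t *: w);
    [apply: (cone_s.2) => //; apply: ltW|rewrite addrAC subrr add0r].
split=> [|p pp].
  by apply: CD; [apply: CZ => //; apply: ltW|exact: degree_cone_row].
have := wP p pp; have := tP p; case: eqVneq => [->|_ /(_ isT)].
  by rewrite mulr0 ltxx.
by case: (s p); rewrite (expr0, expr1); nra.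
Qed.

Lemma row_space_span : [set v : 'rV[R]_n | (v <= map_mx ratr degree_mx)%MS] =
  [set` <<[seq of_rat R v | v <- [seq row i degree_mx | i <- enum 'I_N]]>>%VS].
Proof.
rewrite -map_comp; set X := [seq _ | i <- _].
have rowX i : row i (map_mx ratr degree_mx) \in X.
  by rewrite -map_row; apply: map_f; rewrite mem_enum.
apply/seteqP; split=> v /=.
  move=> /submxP[c ->]; rewrite mulmx_sum_row; apply: memv_suml => i _.
  by apply: memvZ; apply: memv_span.
move=> /coord_span ->; apply: summx_sub => i _; apply: scalemx_sub.
have /mapP[j _ ->] : X`_i \in X by apply: mem_nth; rewrite size_map -cardE ltn_ord.
by rewrite /= /of_rat map_row row_sub.
Qed.

(** Subtracting a small multiple of an interior point keeps [x] in the cell, so [x] must be strictly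
    inside every wall. *)
Lemma rel_int_cell s x :
  cell_interior s !=set0 -> rel_int (cell s) x -> cell_interior s x.
Proof.
move=> [w sw] sx; have [Cw wP] := sw; have sw' := cell_interior_sub sw.
have [t t_gt0 [_ xtP]] := rel_int_shrink (cell_is_cone s) sx sw'.
case: sx => -[Cx xP] _; split=> // p pp.
have := wP p pp; have := xtP p pp.
rewrite -scaleNr pairingD pairingZ; case: (s p); rewrite (expr0, expr1); nra.
Qed.

Lemma same_side_cell s (a b : 'rV[rat]_n) :
  cell_interior s (of_rat R a) -> cell_interior s (of_rat R b) -> same_side a b.
Proof.
move=> [_ aP] [_ bP] F j Fj; have pp : proper_wall (F, j).
  rewrite /proper_wall /wall_form -map_mxM /=; apply: contra Fj => /eqP Fj.
  by apply/eqP/(@map_mx_inj _ _ (@ratr R)); rewrite Fj map_mx0.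
have := mulr_gt0 (aP _ pp) (bP _ pp); rewrite mulrACA -signr_addb addbb mul1r.
by rewrite /wall_form /of_rat -!map_mxM !mxE -rmorphM ltr0q.
Qed.

Lemma cell_chamber s : cell_interior s !=set0 -> chamber G (cell s).
Proof.
move=> s_neq0; split; last first.
  by rewrite /cone_dim cone_diff_cell // cone_diff_degree_cone.
split=> [||a b].
- exact: cell_is_cone.
- by rewrite cone_diff_cell // row_space_span; eexists.
move=> /(rel_int_cell s_neq0) sa /(rel_int_cell s_neq0) sb; split.
  apply/seteqP; split; apply: ray_radical_sub.
  - by apply: degree_cone_rat; case: sb.
  - exact: same_side_cell sa sb.
  - by apply: degree_cone_rat; case: sa.
  - exact: same_side_cell sb sa.
by apply: ray_radical_neq0; [case: sb|exact: (same_side_cell sb sb)].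
Qed.

End Chambers.

Theorem theorem5p1 (R : realType) (n : nat) (A : idomainType)
    (G : 'rV[int]_n -> set A)
    (gradedA : is_grading G) (noetherianA : noetherian A)
    (field_A0 : is_field_subset (G 0)) :
  exists (m : nat) (sigma : 'I_m -> set 'rV[R]_n),
    (forall i : 'I_m, chamber G (sigma i)) /\
    degree_cone R G = \bigcup_(i in [set: 'I_m]) sigma i.
Proof.
have [N [d [dG d_gen]]] := finitely_generated gradedA noetherianA.
have G1 : G 0 1 by case: field_A0.
(* Only sign vectors with nonempty open cell are kept: these cells have full dimension, and there
   are finitely many. *)
pose S := finset (fun s => `[< cell_interior (R := R) G d s !=set0 >]).
exists #|S|, (fun i => cell G d (enum_val i)); split=> [i|].
  apply: cell_chamber => //.
  by have := enum_valP i; rewrite inE => /asboolP.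
apply/seteqP; split=> [v|v [i _ []]] //.
move=> /(cell_cover gradedA dG d_gen)[s [s_neq0 sv]].
have sS : s \in S by rewrite inE; apply/asboolP.
by exists (enum_rank_in sS s) => //; rewrite enum_rankK_in.
Qed.
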